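(* Let $\pi$ be a representation of $U(\mathfrak g)$ on a vector space $M$ (not necessarily finite-dimensional) and assume that $\pi$ has an infinitesimal character $\chi$. Let $s\in M$ and $s'\in M^*$ be such that the linear functional $f\in U(\mathfrak g)^*$ defined by $f(u)=s'(\pi(u)s)$, for $u\in U(\mathfrak g)$, is nonzero with codegree $k\geq 1$. Then $f_{(k)}$ is harmonic, that is, $f_{(k)}\in H^k$.
   Context: Let $\mathfrak g$ be a complex semisimple Lie algebra of rank $\ell$ and $G$ a simply-connected complex Lie group with Lie algebra $\mathfrak g$. A representation $\pi:U(\mathfrak g)\to\mathrm{End}\,M$ has infinitesimal character $\chi:\mathrm{cent}\,U(\mathfrak g)\to\mathbb C$ if $\pi(z)=\chi(z)\,\mathrm{Id}_M$ for every $z$ in the center $\mathrm{cent}\,U(\mathfrak g)$ of $U(\mathfrak g)$. The Killing form $(x,y)$ on $\mathfrak g$ is extended to the nonsingular symmetric bilinear form on the symmetric algebra $S(\mathfrak g)$ for which $S^m(\mathfrak g)$ and $S^n(\mathfrak g)$ are orthogonal when $m\neq n$ and $(x^n,y^n)=n!\,(x,y)^n$ for $x,y\in\mathfrak g$. $S(\mathfrak g)$ is identified with the algebra of polynomial functions on $\mathfrak g$ via $x^n(y)=(x,y)^n$, and $u\mapsto\partial_u$ is the isomorphism of $S(\mathfrak g)$ with the algebra of constant-coefficient differential operators on $\mathfrak g$ (for $x\in \mathfrak g$, $\partial_x$ is the directional derivative along $x$); one has $(u,vw)=(\partial_v u,w)$ for $u,v,w\in S(\mathfrak g)$. Let $J=S(\mathfrak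 g)^G=\mathbb C[p_1,\dots,p_\ell]$, with $p_1,\dots,p_\ell$ homogeneous generators (of positive degree). An element $q\in S(\mathfrak g)$ is harmonic if $\partial_{p_i}q=0$ for $i=1,\dots,\ell$; $H\subset S(\mathfrak g)$ is the graded space of harmonic elements and $H^k=H\cap S^k(\mathfrak g)$. Let $\tau:S(\mathfrak g)\to U(\mathfrak g)$ be the symmetrization map, i.e. the linear isomorphism sending $x^k\in S^k(\mathfrak g)$ to the $k$-th power of $x$ in $U(\mathfrak g)$, for all $x\in\mathfrak g$, $k\ge0$. Let $U_n(\mathfrak g)$, $n\in\mathbb N$, be the standard filtration of $U(\mathfrak g)$, with $U_{-1}(\mathfrak g)=0$. A nonzero linear functional $f$ on $U(\mathfrak g)$ has codegree $k\in\mathbb N$ if $k$ is maximal such that $f$ vanishes on $U_{k-1}(\mathfrak g)$. If $f$ has codegree $k\geq1$, then $f_{(k)}\in S^k(\mathfrak g)$ denotes the element representing, with respect to the bilinear form $(\cdot,\cdot)$ on $S(\mathfrak g)$ extending the Killing form, the linear functional $f\circ\tau|_{S^k(\mathfrak g)}$; that is, $(f_{(k)},w)=f(\tau(w))$ for all $w\in S^k(\mathfrak g)$. *)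

(* Defs.v *)
From HB Require Import structures.
From mathcomp Require Import all_boot all_order all_algebra.
From mathcomp Require Import reals complex mpoly.

Set Implicit Arguments.
Unset Strict Implicit.
Unset Printing Implicit Defensive.

Import Order.TTheory GRing.Theory Num.Theory.
Local Open Scope ring_scope.
Local Open Scope complex_scope.

Record lieAlgebra (K : fieldType) := LieAlgebra {
  lie_carrier :> vectType K;
  lie : lie_carrier -> lie_carrier -> lie_carrier;
  lie_linear_l : forall y, linear (lie^~ y);
  lie_linear_r : forall x, linear (lie x);
  lie_alt : forall x, lie x x = 0;
  lie_jacobi : forall x y z,
    lie x (lie y z) + lie y (lie z x) + lie z (lie x y) = 0
}.

Section LieAlgebra.
Variables (K : fieldType) (g : lieAlgebra K).

Definition lie_ideal (I : {vspace g}) : Prop :=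
  forall x y, y \in I -> lie x y \in I.

Definition lie_subalgebra (V : {vspace g}) : Prop :=
  forall x y, x \in V -> y \in V -> lie x y \in V.

(* [U, V], the span of all brackets; bases suffice by bilinearity. *)
Definition lie_span (U V : {vspace g}) : {vspace g} :=
  <<[seq lie x y | x <- vbasis U, y <- vbasis V]>>%VS.

Definition lie_solvable (V : {vspace g}) : Prop :=
  exists n, iter n (fun W => lie_span W W) V = 0%VS.

Definition lie_nilpotent (V : {vspace g}) : Prop :=
  exists n, iter n (lie_span V) V = 0%VS.

Definition lie_semisimple : Prop :=
  forall I : {vspace g}, lie_ideal I -> lie_solvable I -> I = 0%VS.

Definition cartan_subalgebra (h : {vspace g}) : Prop :=
  [/\ lie_subalgebra h, lie_nilpotent h &
      forall x, (forall y, y \in h -> lie x y \in h) -> x \in h].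

Definition lie_rank (l : nat) : Prop :=
  exists h : {vspace g}, cartan_subalgebra h /\ \dim h = l.

Definition killing (x y : g) : K :=
  \sum_(i < \dim {:g})
    coord (vbasis {:g}) i (lie x (lie y (vbasis {:g})`_i)).

(* The pair (U, j) is the universal enveloping algebra of g. *)
Record is_enveloping (U : algType K) (j : {linear g -> U}) : Prop :=
  IsEnveloping {
    enveloping_lie : forall x y, j (lie x y) = j x * j y - j y * j x;
    enveloping_lift : forall (A : algType K) (a : {linear g -> A}),
      (forall x y, a (lie x y) = a x * a y - a y * a x) ->
      exists F : {lrmorphism U -> A}, forall x, F (j x) = a x;
    enveloping_unique : forall (A : algType K) (F G : {lrmorphism U -> A}),
      (forall x, F (j x) = G (j x)) -> forall u, F u = G u
  }.

End LieAlgebra.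

(* S(g) is realised as the polynomial algebra on the basis (vbasis {:g}):
   'X_i is the i-th basis vector and S^k(g) is the k.-homog part. *)
Notation sym_alg K g := {mpoly K[\dim {: lie_carrier g}]}.

Section SymmetricAlgebra.
Variables (K : fieldType) (g : lieAlgebra K).
Local Notation n := (\dim {:g}).
Local Notation e := (vbasis {:g}).
Local Notation S := (sym_alg K g).

Definition sym_in (x : g) : S := \sum_(i < n) coord e i x *: 'X_i.

(* The algebra endomorphism of S(g) extending phi : g -> g. *)
Definition sym_map (phi : 'End(g)) (p : S) : S :=
  p \mPo [tuple sym_in (phi e`_i) | i < n].

Record killing_extension (B : S -> S -> K) : Prop := KillingExtension {
  kext_linear : forall u, scalar (B u);
  kext_sym : forall u w, B u w = B w u;
  kext_nonsing : forall u, (forall w, B u w = 0) -> u = 0;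
  kext_orth : forall m k u w,
    u \is m.-homog -> w \is k.-homog -> m != k -> B u w = 0;
  kext_pow : forall k x y,
    B (sym_in x ^+ k) (sym_in y ^+ k) = k`!%:R * killing x y ^+ k
}.

(* As a polynomial function on g, 'X_i is y |-> (e_i, y), whose derivative
   along x is the constant (x, e_i). *)
Definition dir_deriv (x : g) (w : S) : S :=
  \sum_(i < n) killing x e`_i *: w^`M(i).

(* The operator attached to u: substitute dir_deriv e_i for each 'X_i in u
   (these operators commute, so the order of composition is irrelevant). *)
Definition sym_deriv (u w : S) : S :=
  \sum_(m <- msupp u)
    u@_m *: (\big[comp/id]_(i < n) iter (m i) (dir_deriv e`_i)) w.

Definition harmonic (l : nat) (p : l.-tuple S) (q : S) : Prop :=
  forall i : 'I_l, sym_deriv (tnth p i) q = 0.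

Definition is_symmetrization (U : algType K) (j : {linear g -> U})
    (tau : {linear S -> U}) : Prop :=
  forall x k, tau (sym_in x ^+ k) = j x ^+ k.

End SymmetricAlgebra.

(* A connected Lie group G with Lie algebra g acts on g, hence on S(g),
   through Ad(G), the group generated by the exp(ad x). *)
Section AdjointGroup.
Variables (R : realType) (g : lieAlgebra R[i]).
Local Notation n := (\dim {:g}).
Local Notation e := (vbasis {:g}).

(* phi = exp(ad x): the exponential series converges to phi pointwise, in
   coordinates. *)
Definition is_exp_ad (x : g) (phi : 'End(g)) : Prop :=
  forall (y : g) (i : 'I_n) (eps : R), 0 < eps ->
  exists N0 : nat, forall N : nat, (N0 <= N)%N ->
    `| coord e i (\sum_(k < N) (k`!%:R)^-1 *: iter k (lie x) y - phi y) |
      < eps%:C.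

Inductive adjoint_group : 'End(g) -> Prop :=
| Ad_id : adjoint_group \1%VF
| Ad_exp x phi psi : is_exp_ad x phi -> adjoint_group psi ->
    adjoint_group (phi \o psi)%VF.

Definition sym_invariant (q : sym_alg R[i] g) : Prop :=
  forall phi, adjoint_group phi -> sym_map phi q = q.

(* J = S(g)^G is the polynomial algebra C[p_1, ..., p_l], with the p_i
   homogeneous of positive degree. *)
Definition invariant_generators (l : nat) (p : l.-tuple (sym_alg R[i] g))
    : Prop :=
  [/\ forall i, exists2 d, (0 < d)%N & tnth p i \is d.-homog,
      forall q, sym_invariant q <->
        exists P : {mpoly R[i][l]}, q = P \mPo p &
      forall P : {mpoly R[i][l]}, P \mPo p = 0 -> P = 0].

End AdjointGroup.

Section Enveloping.
Variables (K : fieldType) (g : lieAlgebra K).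
Variables (U : algType K) (j : {linear g -> U}).

(* The standard filtration, indexed by int so that U_{-1} = 0. *)
Definition U_filt (d : int) (u : U) : Prop :=
  exists s : seq (K * seq g),
    (forall t, t \in s -> (size t.2)%:Z <= d) /\
    u = \sum_(t <- s) t.1 *: \prod_(x <- t.2) j x.

Definition vanishes_on_filt (f : U -> K) (d : int) : Prop :=
  forall u, U_filt d u -> f u = 0.

Definition has_codegree (f : U -> K) (k : nat) : Prop :=
  [/\ exists u, f u != 0,
      vanishes_on_filt f (k%:Z - 1) &
      forall k' : nat, vanishes_on_filt f (k'%:Z - 1) -> (k' <= k)%N].

(* q is f_(k), relative to the form B on S(g) and symmetrization tau. *)
Definition is_leading_symbol (B : sym_alg K g -> sym_alg K g -> K)
    (tau : {linear sym_alg K g -> U}) (f : U -> K) (k : nat)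
    (q : sym_alg K g) : Prop :=
  q \is k.-homog /\
  forall w : sym_alg K g, w \is k.-homog -> B q w = f (tau w).

Definition is_central (z : U) : Prop := forall u, z * u = u * z.

Record is_representation (M : lmodType K) (pi : U -> M -> M) : Prop :=
  IsRepresentation {
    rep_linear_l : forall m, linear (pi^~ m);
    rep_linear_r : forall u, linear (pi u);
    rep_one : forall m, pi 1 m = m;
    rep_mul : forall u v m, pi (u * v) m = pi u (pi v m)
  }.

Definition has_infinitesimal_character (M : lmodType K) (pi : U -> M -> M)
    (chi : {z : U | is_central z} -> K) : Prop :=
  forall (z : {z : U | is_central z}) (m : M),
    pi (sval z) m = chi z *: m.

End Enveloping.

(* Main.v *)
(* Write f(u) = s'(pi(u)s), of codegree k, and let p be an invariant of degree d > 0.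
   By nonsingularity and adjointness it suffices that (f_(k), p w) = f(tau(p w)) vanishes
   for w in S^(k-d). Modulo U_(k-1), where f is zero, tau(p w) is tau(p) tau(w); since
   tau(p) is central it acts by a scalar, so the value is a multiple of f(tau(w)), and
   tau(w) lies in U_(k-d), contained in U_(k-1).
   Centrality of tau(p): differentiating p o exp(t ad x) = p at t = 0 shows that the
   derivation D_x of S(g) extending ad x kills p, and tau intertwines D_x with the
   commutator with x. Identities on S(g) are checked on the powers x^k, which span. *)

Require Import Defs.
From HB Require Import structures.
From mathcomp Require Import all_boot all_order all_algebra.
From mathcomp Require Import reals complex mpoly ring lra.

Set Implicit Arguments.
Unset Strict Implicit.
Unset Printing Implicit Defensive.

Import Order.TTheory GRing.Theory Num.Theory.
Local Open Scope ring_scope.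

(** * Polarization *)

(** An identity linear in one variable holds on a subspace. With [Prop]-valued predicates the
    identity itself can be the induction motive, to be checked on a spanning set. *)
Definition subspace_pred (K : fieldType) (V : lmodType K) (Q : V -> Prop) :=
  Q 0 /\ forall a u v, Q u -> Q v -> Q (a *: u + v).

Section SubspacePred.
Variables (K : numFieldType) (V : lmodType K) (Q : V -> Prop).
Hypothesis Qsub : subspace_pred Q.

Lemma subspace_scale a u : Q u -> Q (a *: u).
Proof. by move=> Qu; rewrite -[_ *: _]addr0; case: Qsub => Q0; apply. Qed.

Lemma subspace_add u v : Q u -> Q v -> Q (u + v).
Proof. by move=> Qu Qv; rewrite -[u]scale1r; apply: Qsub.2. Qed.

Lemma subspace_opp u : Q u -> Q (- u).
Proof. by rewrite -scaleN1r; apply: subspace_scale. Qed.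

Lemma subspace_sub u v : Q u -> Q v -> Q (u - v).
Proof. by move=> Qu Qv; apply: subspace_add => //; apply: subspace_opp. Qed.

Lemma subspace_sum (I : eqType) (r : seq I) (F : I -> V) :
  (forall i, i \in r -> Q (F i)) -> Q (\sum_(i <- r) F i).
Proof.
move=> QF; rewrite big_seq; apply: big_ind => //; first exact: Qsub.1.
exact: subspace_add.
Qed.

Lemma subspace_unscale a u : a != 0 -> Q (a *: u) -> Q u.
Proof. by move=> a0 /(subspace_scale a^-1); rewrite scalerA mulVf ?scale1r. Qed.

(* Replacing F(t) by F(2t) - 2^N F(t) kills the top coefficient. *)
Lemma subspace_coef N (v : nat -> V) :
  (forall t, Q (\sum_(i < N) t ^+ i *: v i)) ->
  forall i, (i < N)%N -> Q (v i).
Proof.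
elim: N v => [|N IH] v Qv i //.
have lowQ i' : (i' < N)%N -> Q (v i').
  move=> lti; have a0 : (2 : K) ^+ i' - 2 ^+ N != 0.
    by rewrite subr_eq0 -!natrX eqr_nat eqn_exp2l // ltn_eqF.
  apply: (subspace_unscale a0).
  apply: (IH (fun i => (2 ^+ i - 2 ^+ N) *: v i)) => // t.
  have := subspace_sub (Qv (2 * t)) (subspace_scale (2 ^+ N) (Qv t)).
  rewrite !big_ord_recr /= scalerDr opprD addrACA scalerA -exprMn subrr addr0.
  rewrite scaler_sumr -sumrB; congr Q; apply: eq_bigr => j _.
  by rewrite !scalerA exprMn -scalerBl -mulrBl mulrC.
rewrite ltnS leq_eqVlt => /orP[/eqP-> | /lowQ //].
have := Qv 1; rewrite big_ord_recr /= expr1n scale1r => QN.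
rewrite -[v N](addKr (\sum_(i0 < N) 1 ^+ i0 *: v i0)).
apply: subspace_add => //; apply: subspace_opp.
apply: subspace_sum => j _; apply: subspace_scale; exact: lowQ.
Qed.

End SubspacePred.

(* The coefficient of t^i in (a + t b)^k, for possibly noncommuting a, b. *)
Fixpoint expD_coef (A : nzRingType) (a b : A) k i : A :=
  if k is k'.+1 then
    a * expD_coef a b k' i + (if i is i'.+1 then b * expD_coef a b k' i' else 0)
  else (i == 0%N)%:R.

Lemma expD_coef0 (A : nzRingType) (a b : A) k : expD_coef a b k 0 = a ^+ k.
Proof. by elim: k => //= k ->; rewrite addr0 exprS. Qed.

Section ExpDCoef.
Variables (K : fieldType) (A : algType K).
Implicit Types a b : A.

Lemma expD_coef_gt a b k i : (k < i)%N -> expD_coef a b k i = 0.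
Proof.
elim: k i => [|k IH] [|i] //= lti.
by rewrite !IH ?mulr0 ?addr0 // ltnW.
Qed.

Lemma expD_coefE a b k t :
  (a + t *: b) ^+ k = \sum_(i < k.+1) t ^+ i *: expD_coef a b k i.
Proof.
elim: k => [|k IH]; first by rewrite expr0 big_ord1 expr0 scale1r.
rewrite exprS IH mulrDl.
transitivity (\sum_(i < k.+2) t ^+ i *: (a * expD_coef a b k i) +
   \sum_(i < k.+2) t ^+ i *: (if (i : nat) is i'.+1 then b * expD_coef a b k i' else 0)).
  congr (_ + _).
    rewrite [RHS]big_ord_recr /= expD_coef_gt // mulr0 scaler0 addr0 mulr_sumr.
    by apply: eq_bigr => i _; rewrite scalerAr.
  rewrite [RHS]big_ord_recl scaler0 add0r mulr_sumr.
  by apply: eq_bigr => i _; rewrite /= exprS -scalerAl -scalerAr scalerA.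
by rewrite -big_split; apply: eq_bigr => i _; rewrite [RHS]scalerDr.
Qed.

(** The linear coefficient puts [d a] in each of the [k] positions of the word [a ^+ k], which is
    the Leibniz rule. The order of factors is kept, so this serves both S(g) and commutators in
    U. *)
Lemma expD_coef1_deriv (d : A -> A) a k :
    d 1 = 0 -> (forall x y, d (x * y) = d x * y + x * d y) ->
  expD_coef a (d a) k 1 = d (a ^+ k).
Proof.
move=> d1 dM; elim: k => [|k IH] /=; first by rewrite d1.
by rewrite IH expD_coef0 exprS dM addrC.
Qed.

End ExpDCoef.

Lemma expD_coef1_comm (A : comNzRingType) (a b : A) k :
  expD_coef a b k.+1 1 = (a ^+ k * b) *+ k.+1.
Proof.
elim: k => [|k IH]; first by rewrite /= mulr0 add0r mulr1 expr0 mul1r.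
rewrite [LHS]/= -/(expD_coef a b k.+1 1) -/(expD_coef a b k.+1 0) IH expD_coef0.
by rewrite -mulrnAr mulrA -exprS mulrnAr [b * _]mulrC -mulrSr.
Qed.

(** Both sides are polynomials in [t] that agree on an infinite field, so their coefficients agree:
    [subspace_coef] for the zero subspace. The scalar [e] makes room for the factorial in the
    pairing of powers. *)
Lemma linear_expD_coef (K : numFieldType) (A B : algType K) (F : {linear A -> B})
    (a b : A) (c d : B) k (e : K) :
    (forall t, F ((a + t *: b) ^+ k) = e *: (c + t *: d) ^+ k) ->
  forall i, (i <= k)%N -> F (expD_coef a b k i) = e *: expD_coef c d k i.
Proof.
move=> eqF i lei; apply/eqP; rewrite -subr_eq0; apply/eqP.
pose Q (v : B) := v = 0.
have Qsub : subspace_pred Q.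
  by split=> // x u v; rewrite /Q => -> ->; rewrite scaler0 addr0.
apply: (subspace_coef Qsub (N := k.+1)
  (v := fun i => F (expD_coef a b k i) - e *: expD_coef c d k i)) => // t.
under eq_bigr do rewrite scalerBr scalerA mulrC -scalerA -linearZ.
by rewrite sumrB -linear_sum -scaler_sumr -!expD_coefE eqF /Q subrr.
Qed.

(** * The symmetric algebra *)

Section SymIn.
Variables (K : numFieldType) (g : lieAlgebra K).
Local Notation n := (\dim {:g}).
Local Notation e := (vbasis {:g}).
Local Notation S := (sym_alg K g).
Local Notation sym_in := (@sym_in K g).

Lemma sym_in_is_linear : linear sym_in.
Proof.
move=> a x y; rewrite /Defs.sym_in scaler_sumr -big_split; apply: eq_bigr => i _ /=.
by rewrite linearP scalerDl scalerA.
Qed.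

HB.instance Definition _ := GRing.isLinear.Build K g S _ sym_in sym_in_is_linear.

Lemma coord_basis (i j : 'I_n) : coord e i e`_j = (i == j)%:R.
Proof. by rewrite eq_sym coord_free ?(basis_free (vbasisP _)). Qed.

Lemma basisE (x : g) : x = \sum_(i < n) coord e i x *: e`_i.
Proof. exact: coord_vbasis (memvf x). Qed.

Lemma sym_in_basis (i : 'I_n) : sym_in e`_i = 'X_i.
Proof.
rewrite /Defs.sym_in (bigD1 i) //= coord_basis eqxx scale1r big1 ?addr0 // => j ji.
by rewrite coord_basis (negPf ji) scale0r.
Qed.

Lemma sym_monomial (m : 'X_{1.. n}) :
  exists2 ys : seq g, size ys = mdeg m & 'X_[m] = \prod_(y <- ys) sym_in y.
Proof.
exists (flatten [seq nseq (m i) e`_i | i : 'I_n]).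
  rewrite size_flatten /shape -map_comp sumnE big_map mdegE big_enum.
  by apply: eq_big => // i _; rewrite /= size_nseq.
rewrite big_flatten big_map mpolyXE_id big_enum; apply: eq_big => // i _.
by rewrite big_nseq -sym_in_basis; elim: (m i) => //= k <-; rewrite exprS.
Qed.

(** The coefficient of t in (x + t y)^(k+1) is (k+1) y x^k, and k+1 is invertible in characteristic
    zero. *)
Lemma sym_polarize (Q : S -> Prop) k : subspace_pred Q ->
    (forall x, Q (sym_in x ^+ k.+1)) ->
  forall x y, Q (sym_in y * sym_in x ^+ k).
Proof.
move=> Qsub Qpow x y.
have QC : Q (expD_coef (sym_in x) (sym_in y) k.+1 1).
  apply: (subspace_coef Qsub (N := k.+2)) => // t.
  rewrite -expD_coefE -linearZ -linearD. exact: Qpow.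
apply: (subspace_unscale Qsub (a := k.+1%:R)); first by rewrite pnatr_eq0.
by rewrite scaler_nat mulrC -expD_coef1_comm.
Qed.

(** Polarization trades one power for a factor [y]; the induction continues with the subspace of
    those [p] for which [sym_in y * p] satisfies [Q]. *)
Lemma sym_powers_prod (Q : S -> Prop) (ys : seq g) : subspace_pred Q ->
    (forall x, Q (sym_in x ^+ size ys)) -> Q (\prod_(y <- ys) sym_in y).
Proof.
elim: ys Q => [|y ys IH] Q Qsub Qpow.
  by rewrite big_nil -(expr0 (sym_in 0)).
rewrite big_cons; apply: (IH (fun p => Q (sym_in y * p))).
  split=> [|a u v Qu Qv]; first by rewrite mulr0; case: Qsub.
  by rewrite mulrDr -scalerAr; apply: Qsub.2.
by move=> x; apply: sym_polarize.
Qed.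

Lemma sym_homog_ind (Q : S -> Prop) d : subspace_pred Q ->
    (forall ys : seq g, size ys = d -> Q (\prod_(y <- ys) sym_in y)) ->
  forall p, p \is d.-homog -> Q p.
Proof.
move=> Qsub Qprod p /dhomogP pd; rewrite [p]mpolyE.
apply: subspace_sum => // m mp; apply: subspace_scale => //.
by have [ys sys ->] := sym_monomial m; apply: Qprod; rewrite sys; apply: pd.
Qed.

Lemma sym_powers_span (Q : S -> Prop) d : subspace_pred Q ->
  (forall x, Q (sym_in x ^+ d)) -> forall p, p \is d.-homog -> Q p.
Proof.
move=> Qsub Qpow; apply: sym_homog_ind => // ys sys.
by apply: sym_powers_prod => //; rewrite sys.
Qed.

Lemma sym_powers_ind (Q : S -> Prop) : subspace_pred Q ->
  (forall x d, Q (sym_in x ^+ d)) -> forall p, Q p.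
Proof.
move=> Qsub Qpow p; rewrite [p]mpolyE.
apply: subspace_sum => // m _; apply: subspace_scale => //.
by apply: (sym_powers_span (d := mdeg m)) => //; rewrite dhomogX /=.
Qed.

Lemma sym_in_homog x : sym_in x \is 1.-homog.
Proof.
rewrite rpred_sum // => i _; apply: rpredZ.
by rewrite dhomogX /= mdeg1.
Qed.

Lemma sym_prod_homog (ys : seq g) : \prod_(y <- ys) sym_in y \is (size ys).-homog.
Proof.
elim: ys => [|y ys IH]; first by rewrite big_nil dhomog1.
by rewrite big_cons -[size _]add1n dhomogM ?sym_in_homog.
Qed.

Lemma sym_pow_homog x k : sym_in x ^+ k \is k.-homog.
Proof. by have := dhomogMn k (sym_in_homog x); rewrite mul1n. Qed.

(* The derivation of S(g) extending ad x. *)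
Definition sym_ad (x : g) (p : S) : S :=
  \sum_(i < n) sym_in (lie x e`_i) * p^`M(i).

Lemma sym_ad_is_linear x : linear (sym_ad x).
Proof.
move=> a p q; rewrite /sym_ad scaler_sumr -big_split; apply: eq_bigr => i _ /=.
by rewrite mderivD mderivZ mulrDr scalerAr.
Qed.

HB.instance Definition _ x :=
  GRing.isLinear.Build K S S _ (sym_ad x) (sym_ad_is_linear x).

Lemma sym_adM x p q : sym_ad x (p * q) = sym_ad x p * q + p * sym_ad x q.
Proof.
rewrite /sym_ad mulr_suml mulr_sumr -big_split; apply: eq_bigr => i _ /=.
by rewrite mderivM mulrDr mulrA mulrCA.
Qed.

Lemma sym_ad1 x : sym_ad x 1 = 0.
Proof. by rewrite /sym_ad big1 // => i _; rewrite -mpolyC1 mderivC mulr0. Qed.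

Lemma mderiv_sym_in i y : (sym_in y)^`M(i) = (coord e i y)%:MP.
Proof.
rewrite /Defs.sym_in raddf_sum (bigD1 i) //= mderivZ mderivX mnm1E eqxx.
rewrite big1 => [|j ji].
  rewrite addr0 scale1r (_ : (U_(i) - U_(i))%MM = 0%MM).
    by rewrite mpolyX0 -mul_mpolyC mulr1.
  by apply/mnmP => j; rewrite mnmBE mnm0E subnn.
by rewrite [LHS]mderivZ mderivX mnm1E (negPf ji) scale0r scaler0.
Qed.

HB.instance Definition _ (x : g) :=
  GRing.isLinear.Build K g g _ (lie x) (lie_linear_r x).

Lemma sym_ad_in x y : sym_ad x (sym_in y) = sym_in (lie x y).
Proof.
have -> : lie x y = \sum_(i < n) coord e i y *: lie x e`_i.
  by rewrite [in LHS](basisE y) linear_sum; apply: eq_bigr => i _; rewrite linearZ.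
rewrite [RHS]linear_sum; apply: eq_bigr => i _.
by rewrite mderiv_sym_in mulrC mul_mpolyC linearZ.
Qed.

End SymIn.

(** * Dual numbers and centrality *)

Section DualNumbers.
Variables (K : fieldType) (U : algType K).

(** The algebra U[eps] with eps^2 = 0, the pair (a, b) being a + eps b. A separate name keeps its
    product apart from the componentwise one on [U * U]. *)
Definition dual_numbers : Type := (U * U)%type.

HB.instance Definition _ := GRing.Lmodule.on dual_numbers.

Definition dual_one : dual_numbers := (1, 0).
Definition dual_mul (x y : dual_numbers) : dual_numbers :=
  (x.1 * y.1, x.1 * y.2 + x.2 * y.1).

Fact dual_mulA : associative dual_mul.
Proof.
by move=> x y z; rewrite /dual_mul /= mulrA mulrDl mulrDr !mulrA addrA.
Qed.

Fact dual_mul1l : left_id dual_one dual_mul.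
Proof. by case=> a b; rewrite /dual_mul /= !mul1r mul0r addr0. Qed.

Fact dual_mul1r : right_id dual_one dual_mul.
Proof. by case=> a b; rewrite /dual_mul /= !mulr1 mulr0 add0r. Qed.

Fact dual_mulDl : left_distributive dual_mul +%R.
Proof.
by move=> x y z; congr (_, _); rewrite /= !mulrDl // addrACA.
Qed.

Fact dual_mulDr : right_distributive dual_mul +%R.
Proof.
by move=> x y z; congr (_, _); rewrite /= !mulrDr // addrACA.
Qed.

Fact dual_one_neq0 : dual_one != 0.
Proof. by apply/eqP => /(congr1 fst)/eqP; rewrite oner_eq0. Qed.

HB.instance Definition _ := GRing.Zmodule_isNzRing.Build dual_numbers
  dual_mulA dual_mul1l dual_mul1r dual_mulDl dual_mulDr dual_one_neq0.

Fact dual_scaleAl (a : K) (x y : dual_numbers) : a *: dual_mul x y = dual_mul (a *: x) y.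
Proof. by congr (_, _); rewrite /= ?scalerDr !scalerAl. Qed.

HB.instance Definition _ :=
  GRing.Lmodule_isLalgebra.Build K dual_numbers dual_scaleAl.

Fact dual_scaleAr (a : K) (x y : dual_numbers) : a *: dual_mul x y = dual_mul x (a *: y).
Proof. by congr (_, _); rewrite /= ?scalerDr !scalerAr. Qed.

HB.instance Definition _ := GRing.Lalgebra_isAlgebra.Build K dual_numbers dual_scaleAr.

Definition dual_const (u : U) : dual_numbers := (u, 0).

Fact dual_const_linear : linear dual_const.
Proof. by move=> a u v; congr (_, _); rewrite /= scaler0 addr0. Qed.

Fact dual_const_monoid : monoid_morphism dual_const.
Proof. by split=> // u v; congr (_, _); rewrite /= mulr0 mul0r addr0. Qed.

HB.instance Definition _ :=
  GRing.isLinear.Build K U dual_numbers _ dual_const dual_const_linear.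
HB.instance Definition _ :=
  GRing.isMonoidMorphism.Build U dual_numbers dual_const dual_const_monoid.

Variable z : U.

Definition dual_comm (u : U) : dual_numbers := (u, z * u - u * z).

Fact dual_comm_linear : linear dual_comm.
Proof.
move=> a u v; congr (_, _); rewrite /= mulrDr mulrDl -scalerAl -scalerAr.
by rewrite scalerBr opprD addrACA.
Qed.

(** Multiplicativity is the Leibniz rule for the commutator with [z]. *)
Fact dual_comm_monoid : monoid_morphism dual_comm.
Proof.
split=> [|u v]; congr (_, _); rewrite /= ?mulr1 ?mul1r ?subrr //.
by rewrite mulrBl mulrBr !mulrA [RHS]addrC subrKA.
Qed.

HB.instance Definition _ :=
  GRing.isLinear.Build K U dual_numbers _ dual_comm dual_comm_linear.
HB.instance Definition _ :=
  GRing.isMonoidMorphism.Build U dual_numbers dual_comm dual_comm_monoid.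

End DualNumbers.

(* u |-> u + eps [z, u] and u |-> u are morphisms to U[eps] agreeing on g. *)
Lemma enveloping_central (K : fieldType) (g : lieAlgebra K) (U : algType K)
    (j : {linear g -> U}) (z : U) :
  is_enveloping j -> (forall x, z * j x = j x * z) -> is_central z.
Proof.
move=> env zj u.
have /(congr1 snd) /= /eqP := enveloping_unique env
  (F := dual_comm z : {lrmorphism U -> dual_numbers U})
  (G := dual_const (U := U) : {lrmorphism U -> dual_numbers U})
  (fun x => congr1 (pair (j x)) (etrans (congr1 (+%R^~ _) (zj x)) (subrr _))) u.
by rewrite subr_eq0 => /eqP.
Qed.

(** * Symmetrization and the standard filtration *)

Section Filtration.
Variables (K : numFieldType) (g : lieAlgebra K) (U : algType K).
Variable j : {linear g -> U}.

Lemma U_filt_subspace d : subspace_pred (U_filt j d).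
Proof.
split=> [|a u v [su [szu ->]] [sv [szv ->]]].
  by exists [::]; rewrite big_nil; split.
exists ([seq (a * t.1, t.2) | t <- su] ++ sv); split=> [t|].
  by rewrite mem_cat => /orP[/mapP[t' /szu szt ->] // | /szv].
rewrite big_cat big_map scaler_sumr; congr (_ + _).
by apply: eq_bigr => t _; rewrite scalerA.
Qed.

(* Shifted index: U_lt m is U_(m-1), so that U_lt 0 = 0. *)
Definition U_lt (m : nat) : U -> Prop := U_filt j (m%:Z - 1).

Lemma U_lt_subspace m : subspace_pred (U_lt m).
Proof. exact: U_filt_subspace. Qed.
Hint Resolve U_lt_subspace : core.

Lemma word_leP (r m : nat) : (r%:Z <= m%:Z - 1) = (r < m)%N.
Proof. by rewrite lerBrDr -PoszD lez_nat addn1. Qed.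

Lemma U_lt_word m (xs : seq g) : (size xs < m)%N -> U_lt m (\prod_(x <- xs) j x).
Proof.
move=> szx; exists [:: (1, xs)]; rewrite big_seq1 scale1r; split=> // t.
by rewrite inE => /eqP->; rewrite word_leP.
Qed.

Lemma U_lt_ind (Q : U -> Prop) m : subspace_pred Q ->
    (forall xs : seq g, (size xs < m)%N -> Q (\prod_(x <- xs) j x)) ->
  forall u, U_lt m u -> Q u.
Proof.
move=> Qsub Qw u [s [szs ->]]; apply: subspace_sum => // t /szs.
by rewrite word_leP => /Qw; apply: subspace_scale.
Qed.

(** Degrees at most a - 1 and b add up to at most a + b - 1, hence the successor on one index
    only. *)
Lemma U_lt_mul a b u v : U_lt a u -> U_lt b.+1 v -> U_lt (a + b) (u * v).
Proof.
move=> ua vb; apply: (U_lt_ind (Q := fun u => U_lt (a + b) (u * v)) _ _ ua).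
  split=> [|c w w' Qw Qw']; first by rewrite mul0r; apply: (U_lt_subspace _).1.
  by rewrite mulrDl -scalerAl; apply: (U_lt_subspace _).2.
move=> xs szx; set w := \prod_(x <- xs) j x.
apply: (U_lt_ind (Q := fun v => U_lt (a + b) (w * v)) _ _ vb).
  split=> [|c y y' Qw Qw']; first by rewrite mulr0; apply: (U_lt_subspace _).1.
  by rewrite mulrDr -scalerAr; apply: (U_lt_subspace _).2.
move=> ys; rewrite ltnS => szy; rewrite -big_cat; apply: U_lt_word.
by rewrite size_cat -addSn leq_add.
Qed.

Lemma U_lt_mull m x v : U_lt m v -> U_lt m.+1 (j x * v).
Proof.
apply: (U_lt_ind (Q := fun v => U_lt m.+1 (j x * v))).
  split=> [|c y y' Qw Qw']; first by rewrite mulr0; apply: (U_lt_subspace _).1.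
  by rewrite mulrDr -scalerAr; apply: (U_lt_subspace _).2.
by move=> xs szx; have := U_lt_word (m := m.+1) (xs := x :: xs) szx; rewrite big_cons.
Qed.

Lemma U_ltW m m' u : (m <= m')%N -> U_lt m u -> U_lt m' u.
Proof.
move=> mm'; apply: U_lt_ind => // xs szx.
by apply: U_lt_word; apply: leq_trans mm'.
Qed.

Lemma U_lt_pow x m : U_lt m.+1 (j x ^+ m).
Proof.
have := U_lt_word (m := m.+1) (xs := nseq m x); rewrite size_nseq big_nseq => /(_ (leqnn _)).
by rewrite -Monoid.iteropE.
Qed.

End Filtration.
#[global] Hint Resolve U_lt_subspace : core.

(** * Symmetrization: commutators, and products modulo lower filtration *)

Section Symmetrization.
Variables (K : numFieldType) (g : lieAlgebra K) (U : algType K).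
Variables (j : {linear g -> U}) (tau : {linear sym_alg K g -> U}).
Hypotheses (U_env : is_enveloping j) (tau_sym : is_symmetrization j tau).
Local Notation S := (sym_alg K g).
Local Notation sym_in := (@sym_in K g).
Local Notation U_lt := (U_lt j).

Lemma tau_expD x y k i :
  tau (expD_coef (sym_in x) (sym_in y) k i) = expD_coef (j x) (j y) k i.
Proof.
have [lti|lei] := ltnP k i; first by rewrite !expD_coef_gt ?linear0.
rewrite (linear_expD_coef (e := 1) (c := j x) (d := j y)) ?scale1r // => t.
by rewrite -linearZ -linearD tau_sym linearD linearZ scale1r.
Qed.

(** On a power y^k both sides are the linear coefficient of (y + t [x, y])^k, computed in S(g) and
    in U, because [sym_ad x] and the commutator with [j x] are both derivations. *)
Lemma tau_sym_ad x p : tau (sym_ad x p) = j x * tau p - tau p * j x.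
Proof.
elim/sym_powers_ind: p; last move=> y k.
  split=> [|a p q Qp Qq]; first by rewrite !linear0 mulr0 mul0r subrr.
  rewrite 2!linearP Qp Qq linearP mulrDr mulrDl scalerBr -scalerAl -scalerAr.
  by rewrite opprD addrACA.
rewrite -(expD_coef1_deriv _ k (sym_ad1 x) (sym_adM x)) sym_ad_in tau_expD.
rewrite enveloping_lie // tau_sym.
apply: (expD_coef1_deriv (j y) k (d := fun u => j x * u - u * j x)).
  by rewrite mulr1 mul1r subrr.
by move=> u v; rewrite mulrBl mulrBr !mulrA addrA subrK.
Qed.

Lemma tau_central p : (forall x, sym_ad x p = 0) -> is_central (tau p).
Proof.
move=> p_inv; apply: (enveloping_central U_env) => x.
by apply/esym/eqP; rewrite -subr_eq0 -tau_sym_ad p_inv linear0.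
Qed.

(** The coefficient is the sum of the k+1 words x^i y x^(k-i). Moving [y] to the front of each
    produces brackets, and a bracket is again in g, so it shortens the word by one. *)
Lemma expD_coef1_lt x y k :
  U_lt k.+1 (expD_coef (j x) (j y) k.+1 1 - (j y * j x ^+ k) *+ k.+1).
Proof.
elim: k => [|k IH].
  by rewrite /= mulr0 add0r expr0 subrr; apply: (U_lt_subspace _ _).1.
rewrite [expD_coef _ _ _ _]/= -/(expD_coef (j x) (j y) k.+1 1).
rewrite -/(expD_coef (j x) (j y) k.+1 0) expD_coef0 mulrSr opprD addrACA subrr addr0.
(* The first difference is [j x] times the induction hypothesis; the second is k+1 times [x, y]
   x^k. *)
rewrite -(subrKA (j x * (j y * j x ^+ k) *+ k.+1)); apply: subspace_add => //.
  by rewrite -mulrnAr -mulrBr; apply: U_lt_mull.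
rewrite exprS !mulrA -mulrnBl -mulrBl -enveloping_lie // -scaler_nat.
by apply: subspace_scale => //; apply: U_lt_mull; apply: U_lt_pow.
Qed.

Lemma tau_lt w d : w \is d.-homog -> U_lt d.+1 (tau w).
Proof.
move: w; apply: (sym_powers_span (Q := fun w => U_lt d.+1 (tau w)));
  last by move=> x; rewrite tau_sym; apply: U_lt_pow.
split=> [|a u v Qu Qv]; first by rewrite linear0; apply: (U_lt_subspace _ _).1.
by rewrite linearP; apply: (U_lt_subspace _ _).2.
Qed.

(** For w = x^d, the element (d+1) y x^d is a mixed coefficient of a power, whose image under [tau]
    is the sum of words treated in [expD_coef1_lt]. *)
Lemma tau_mul_in_lt y w d : w \is d.-homog ->
  U_lt d.+1 (tau (sym_in y * w) - j y * tau w).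
Proof.
move: w; apply: (sym_powers_span
  (Q := fun w => U_lt d.+1 (tau (sym_in y * w) - j y * tau w))) => [|x].
  split=> [|a u v Qu Qv].
    by rewrite !(mulr0, linear0) addr0; apply: (U_lt_subspace _ _).1.
  rewrite mulrDr -scalerAr !linearP mulrDr -scalerAr opprD addrACA -scalerBr.
  exact: (U_lt_subspace _ _).2.
apply: (subspace_unscale (U_lt_subspace _ _) (a := d.+1%:R)).
  by rewrite pnatr_eq0.
rewrite scalerBr -linearZ !scaler_nat [sym_in y * _]mulrC -expD_coef1_comm.
by rewrite tau_expD tau_sym; apply: expD_coef1_lt.
Qed.

Lemma tau_mul_lt p w m d : p \is m.-homog -> w \is d.-homog ->
  U_lt (m + d) (tau (p * w) - tau p * tau w).
Proof.
move=> pm wd; move: p pm; apply: (sym_homog_ind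
  (Q := fun p => U_lt (m + d) (tau (p * w) - tau p * tau w))) => [|ys <-].
  split=> [|c u v Qu Qv].
    by rewrite !(mul0r, linear0) addr0; apply: (U_lt_subspace _ _).1.
  rewrite mulrDl -scalerAl !linearP mulrDl -scalerAl opprD addrACA -scalerBr.
  exact: (U_lt_subspace _ _).2.
elim: ys => [|y ys IH].
  rewrite big_nil mul1r -[X in tau X * _](expr0 (sym_in 0)) tau_sym expr0 mul1r.
  by rewrite subrr; apply: (U_lt_subspace _ _).1.
rewrite big_cons; set P := \prod_(y <- ys) _; rewrite -mulrA.
have PH : P \is (size ys).-homog by apply: sym_prod_homog.
(* Telescoping through tau(y P w), y tau(P w), y tau(P) tau(w) and tau(y P) tau(w); consecutive
   terms agree modulo lower degree. *)
rewrite -(subrKA (j y * tau (P * w))); apply: subspace_add => //.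
  by apply: tau_mul_in_lt; apply: dhomogM.
rewrite -(subrKA (j y * (tau P * tau w))); apply: subspace_add => //.
  by rewrite -mulrBr; apply: U_lt_mull.
rewrite mulrA -mulrBl; apply: U_lt_mul; last exact: tau_lt.
by rewrite -opprB; apply: subspace_opp => //; apply: tau_mul_in_lt.
Qed.

End Symmetrization.

(** * Adjointness for the Killing form *)

Section KillingAdjunction.
Variables (K : numFieldType) (g : lieAlgebra K).
Variable B : sym_alg K g -> sym_alg K g -> K.
Hypothesis B_ext : killing_extension B.
Local Notation n := (\dim {:g}).
Local Notation e := (vbasis {:g}).
Local Notation S := (sym_alg K g).
Local Notation sym_in := (@sym_in K g).

Lemma killing_is_scalar (x : g) : scalar (killing x).
Proof.
move=> a y z; rewrite /killing mulr_sumr -big_split; apply: eq_bigr => i _ /=.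
by rewrite lie_linear_l !linearP.
Qed.

HB.instance Definition _ x :=
  GRing.isLinear.Build K g K _ (killing x) (killing_is_scalar x).

Lemma killing_sum_basis (x y : g) :
  \sum_(i < n) coord e i y * killing x e`_i = killing x y.
Proof.
rewrite [in RHS](basisE y) linear_sum; apply: eq_bigr => i _.
by rewrite linearZ.
Qed.

Lemma dir_deriv_is_linear (x : g) : linear (dir_deriv x).
Proof.
move=> a p q; rewrite /dir_deriv scaler_sumr -big_split; apply: eq_bigr => i _ /=.
by rewrite mderivD mderivZ scalerDr !scalerA mulrC.
Qed.

HB.instance Definition _ x :=
  GRing.isLinear.Build K S S _ (dir_deriv x) (dir_deriv_is_linear x).

Lemma dir_derivM x (p q : S) :
  dir_deriv x (p * q) = dir_deriv x p * q + p * dir_deriv x q.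
Proof.
rewrite /dir_deriv mulr_suml mulr_sumr -big_split; apply: eq_bigr => i _ /=.
by rewrite mderivM scalerDr scalerAl scalerAr.
Qed.

Lemma dir_deriv1 (x : g) : dir_deriv x 1 = 0 :> S.
Proof. by rewrite /dir_deriv big1 // => i _; rewrite -mpolyC1 mderivC scaler0. Qed.

Lemma dir_deriv_in x y : dir_deriv x (sym_in y) = (killing x y)%:MP :> S.
Proof.
rewrite -killing_sum_basis rmorph_sum; apply: eq_bigr => i _.
by rewrite mderiv_sym_in mulrC rmorphM mul_mpolyC.
Qed.

Lemma dir_deriv_pow x y k :
  dir_deriv x (sym_in y ^+ k) = (k%:R * killing x y) *: sym_in y ^+ k.-1.
Proof.
elim: k => [|k IH]; first by rewrite dir_deriv1 mul0r scale0r.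
rewrite exprS dir_derivM IH dir_deriv_in mul_mpolyC -scalerAr.
case: k {IH} => [|k]; first by rewrite mul0r scale0r addr0 mul1r.
by rewrite -exprS /= -scalerDl -[X in (X + _) *: _]mul1r -mulrDl nat1r.
Qed.

Let Bl a u v y : B (a *: u + v) y = a * B u y + B v y.
Proof. by rewrite 3!(kext_sym B_ext _ y) (kext_linear B_ext). Qed.

Let Br a u v y : B y (a *: u + v) = a * B y u + B y v.
Proof. by rewrite (kext_linear B_ext). Qed.

Let B0r y : B y 0 = 0.
Proof. by have := Br (-1) 0 0 y; rewrite scaler0 addr0 mulN1r addNr. Qed.

Let B0l y : B 0 y = 0.
Proof. by rewrite (kext_sym B_ext). Qed.

Let Bs a u y : B y (a *: u) = a * B y u.
Proof. by rewrite -[a *: u]addr0 Br B0r addr0. Qed.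

Lemma killing_sym (x y : g) : killing x y = killing y x.
Proof.
have := kext_sym B_ext (sym_in x ^+ 1) (sym_in y ^+ 1).
by rewrite !(kext_pow B_ext) !mul1r.
Qed.

(** By bilinearity take q = z^k and w = y^m. Unless k = m+1 both sides vanish by orthogonality of
    degrees; in that case both equal (m+1)! (z, y)^m (x, z). *)
Lemma dir_deriv_adjoint x q w : B (dir_deriv x q) w = B q (sym_in x * w).
Proof.
elim/sym_powers_ind: q; last move=> z k.
  split=> [|a u v Qu Qv]; first by rewrite linear0 !B0l.
  by rewrite linearP !Bl Qu Qv.
elim/sym_powers_ind: w; last move=> y m.
  split=> [|a u v Qu Qv]; first by rewrite mulr0 !B0r.
  by rewrite mulrDr -scalerAr !Br Qu Qv.
have [-> | km] := eqVneq k m.+1; last first.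
  rewrite (kext_orth B_ext (sym_pow_homog z k) _ km).
    (* For k = 0 the exponent [k.-1] is a default value, harmless because its coefficient is 0;
       otherwise the degrees k - 1 and m differ. *)
    rewrite dir_deriv_pow; case: k km => [|k] km.
      by rewrite mul0r scale0r B0l.
    by rewrite (kext_orth B_ext (rpredZ _ (sym_pow_homog z k)) (sym_pow_homog y m)).
  by rewrite -[m.+1]add1n dhomogM ?sym_in_homog ?sym_pow_homog.
(* The value on x y^m comes from polarizing the pairing of z^(m+1) with (y + t x)^(m+1); [K^o]
   presents the scalars as an algebra, so that [linear_expD_coef] applies. *)
pose B' := HB.pack_for {linear S -> K^o} (B (sym_in z ^+ m.+1))
  (GRing.isLinear.Build K S K^o _ (B (sym_in z ^+ m.+1)) (kext_linear B_ext _)).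
have /(_ _ 1%N isT) := linear_expD_coef (F := B') (a := sym_in y) (b := sym_in x)
  (c := killing z y : K^o) (d := killing z x : K^o) (k := m.+1) (e := m.+1`!%:R).
rewrite !expD_coef1_comm => BC.
have {}BC : m.+1%:R * B (sym_in z ^+ m.+1) (sym_in x * sym_in y ^+ m) =
    m.+1`!%:R * (killing z y ^+ m * killing z x *+ m.+1).
  rewrite -Bs scaler_nat [sym_in x * _]mulrC; apply: BC => t.
  by rewrite -!linearZ -!linearD /= (kext_pow B_ext) linearD linearZ.
have m0 : m.+1%:R != 0 :> K by rewrite pnatr_eq0.
apply: (mulfI m0); rewrite BC dir_deriv_pow (kext_sym B_ext) Bs
  (kext_pow B_ext) (killing_sym x z) (killing_sym y z) factS natrM.
by rewrite -mulr_natl; ring.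
Qed.

Lemma sym_deriv_adjoint u q w : B (sym_deriv u q) w = B q (u * w).
Proof.
rewrite /sym_deriv [in RHS](mpolyE u) mulr_suml.
have iter_adj (i : 'I_n) k v y :
    B (iter k (dir_deriv e`_i) v) y = B v ('X_i ^+ k * y).
  elim: k y => [|k IH] y; first by rewrite expr0 mul1r.
  by rewrite /= dir_deriv_adjoint IH sym_in_basis exprSr mulrA.
(* Taking adjoints reverses a composition; commutativity of S(g) restores the order. *)
have word_adj (m : 'X_{1.. n}) v y :
    B ((\big[comp/id]_(i < n) iter (m i) (dir_deriv e`_i)) v) y = B v ('X_[m] * y).
  rewrite mpolyXE_id; move: v y.
  apply: (big_ind2 (fun (F : S -> S) (P : S) => forall v y, B (F v) y = B v (P * y))) => //.
    by move=> v y; rewrite mul1r.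
  by move=> F P F' P' FP FP' v y; rewrite /= FP FP' mulrCA mulrA.
elim: (msupp u : seq _) => [|m s IH]; first by rewrite !big_nil B0l B0r.
by rewrite !big_cons -scalerAl Bl Br IH word_adj.
Qed.

End KillingAdjunction.

(** * The exponential of ad x *)

Section GeometricSeries.
Variable R : realType.
Local Open Scope complex_scope.

(** The intervals of radius 2 C 2^-N around the partial sums are nested: passing to N+1 shrinks the
    radius by C 2^-N, which is the bound on the next term. The limit is the supremum of their left
    ends. *)
Lemma real_geometric_cvg (x : nat -> R) (C : R) :
    (forall m, `|x m| <= C * 2 ^- m) ->
  exists l, forall N, `|\sum_(m < N) x m - l| <= 2 * C * 2 ^- N.
Proof.
move=> xC.
have C0 : 0 <= C by have := xC 0%N; rewrite expr0 invr1 mulr1; apply: le_trans.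
have D0 N : 0 <= 2 * C * 2 ^- N by rewrite !mulr_ge0 // invr_ge0 exprn_ge0.
have DE N : 2 * C * 2 ^- N.+1 = C * 2 ^- N :> R.
  by rewrite exprS invfM mulrA [2 * C]mulrC mulfK ?pnatr_eq0.
pose lo N := \sum_(m < N) x m - 2 * C * 2 ^- N.
pose hi N := \sum_(m < N) x m + 2 * C * 2 ^- N.
have lo_homo : {homo lo : i j / (i <= j)%N >-> i <= j}.
  apply: homo_leq => // [|N]; first exact: le_trans.
  rewrite /lo big_ord_recr /= DE; have := xC N; have := D0 N.
  by rewrite ler_norml => ? /andP[]; lra.
have hi_homo : {homo hi : i j / (i <= j)%N >-> j <= i}.
  apply: (homo_leq (r := fun a b => b <= a)) => // [|N].
    by move=> a b c /[swap]; apply: le_trans.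
  rewrite /hi big_ord_recr /= DE; have := xC N; have := D0 N.
  by rewrite ler_norml => ? /andP[]; lra.
have lo_hi N M : lo N <= hi M.
  apply: (@le_trans _ _ (lo (maxn N M))); first by rewrite lo_homo ?leq_maxl.
  apply: (@le_trans _ _ (hi (maxn N M))); last by rewrite hi_homo ?leq_maxr.
  by rewrite lerD2l (le_trans _ (D0 _)) // oppr_le0.
pose E : R -> Prop := fun y => exists N, y = lo N.
exists (sup E) => N.
have lo_le : lo N <= sup E.
  by apply: ub_le_sup; [exists (hi 0%N) => _ [M ->] | exists N].
have le_hi : sup E <= hi N.
  by apply: ge_sup => [|_ [M ->]] //; exists (lo 0%N), 0%N.
by rewrite ler_norml; move: lo_le le_hi; rewrite /lo /hi => ? ?; apply/andP; split; lra.
Qed.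

Let norm_i : `|'i%C : R[i]| = 1.
Proof. by rewrite normc_def /= expr0n /= add0r expr1n sqrtr1. Qed.

Let norm_real (a : R) : `|a%:C| = `|a|%:C.
Proof. by rewrite normc_def /= expr0n /= addr0 sqrtr_sqr. Qed.

Lemma norm_Im_le (z : R[i]) : `|complex.Im z|%:C <= `|z|.
Proof.
have -> : complex.Im z = complex.Re (- 'i%C * z) by case: z => a b /=; ring.
by apply: le_trans (normc_ge_Re _) _; rewrite normrM normrN norm_i mul1r.
Qed.

Lemma norm_le_ReIm (z : R[i]) :
  `|z| <= (`|complex.Re z| + `|complex.Im z|)%:C.
Proof.
rewrite [X in `|X|]complexE (le_trans (ler_normD _ _)) // normrM rmorphD /=.
by rewrite norm_i mul1r !norm_real.
Qed.

(** The real and imaginary parts each contribute an error 2 C 2^-N, whence the factor 4. *)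
Lemma geometric_cvg (z : nat -> R[i]) (C : R[i]) :
    (forall m, `|z m| <= C * 2 ^- m) ->
  exists l, forall N, `|\sum_(m < N) z m - l| <= 4 * C * 2 ^- N.
Proof.
move=> zC.
have C0 : 0 <= C by have := zC 0%N; rewrite expr0 invr1 mulr1; apply: le_trans.
have [c cE] : exists c, C = c%:C.
  by exists (complex.Re C); rewrite RRe_real ?ger0_real.
have pow2 N : (2 ^- N : R[i]) = (2 ^- N : R)%:C.
  by rewrite fmorphV rmorphXn /= rmorph_nat.
have [|a aP] := @real_geometric_cvg (fun m => complex.Re (z m)) c.
  move=> m; rewrite -lecR rmorphM /= -pow2 -cE.
  exact: le_trans (normc_ge_Re _) (zC m).
have [|b bP] := @real_geometric_cvg (fun m => complex.Im (z m)) c.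
  move=> m; rewrite -lecR rmorphM /= -pow2 -cE.
  exact: le_trans (norm_Im_le _) (zC m).
exists (a +i* b) => N; apply: (le_trans (norm_le_ReIm _)).
have -> : 4 * C * 2 ^- N = (4 * c * 2 ^- N)%:C.
  by rewrite cE pow2 !rmorphM /= rmorph_nat.
rewrite lecR !raddfB /= !raddf_sum.
by have := aP N; have := bP N => /=; lra.
Qed.

End GeometricSeries.

(** * Norm estimates for ad x and the second-order remainder of exp(t ad x) *)

Section ExpAd.
Variables (R : realType) (g : lieAlgebra R[i]).
Local Notation n := (\dim {:g}).
Local Notation e := (vbasis {:g}).
Local Open Scope complex_scope.

Definition coord_norm (y : g) : R[i] := \sum_(i < n) `|coord e i y|.

Lemma coord_norm_ge0 y : 0 <= coord_norm y.
Proof. by apply: sumr_ge0. Qed.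

Lemma coord_le_norm i y : `|coord e i y| <= coord_norm y.
Proof. by rewrite /coord_norm (bigD1 i) //= lerDl sumr_ge0. Qed.

Lemma coord_norm_basis (k : 'I_n) : coord_norm e`_k = 1.
Proof.
rewrite /coord_norm (bigD1 k) //= coord_basis eqxx normr1 big1 ?addr0 // => i ik.
by rewrite coord_basis (negPf ik) normr0.
Qed.

Lemma lie_norm x y :
  coord_norm (lie x y) <= (\sum_(k < n) coord_norm (lie x e`_k)) * coord_norm y.
Proof.
rewrite mulr_suml [leRHS](_ : _ = \sum_(k < n) \sum_(i < n)
  `|coord e i (lie x e`_k)| * coord_norm y); last first.
  by apply: eq_bigr => k _; rewrite mulr_suml.
rewrite exchange_big; apply: ler_sum => i _ /=.
rewrite [in coord e i (lie x y)](basisE y) !linear_sum.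
apply: (le_trans (ler_norm_sum _ _ _)); apply: ler_sum => k _.
by rewrite !linearZ normrM mulrC ler_wpM2l ?coord_le_norm.
Qed.

Lemma iter_lie_norm x m y :
  coord_norm (iter m (lie x) y) <=
    (\sum_(k < n) coord_norm (lie x e`_k)) ^+ m * coord_norm y.
Proof.
have c0 : 0 <= \sum_(k < n) coord_norm (lie x e`_k).
  by apply: sumr_ge0 => k _; apply: coord_norm_ge0.
elim: m => [|m IH]; first by rewrite expr0 mul1r.
rewrite (le_trans (lie_norm _ _)) // exprS -mulrA.
exact: ler_wpM2l.
Qed.

Lemma lieZl t (x y : g) : lie (t *: x) y = t *: lie x y.
Proof.
have l0 : lie 0 y = 0.
  by have := lie_linear_l y (-1) 0 0; rewrite scaler0 addr0 scaleN1r addNr.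
by have := lie_linear_l y t x 0; rewrite l0 !addr0.
Qed.

Lemma iter_lie_scale t (x : g) m y :
  iter m (lie (t *: x)) y = t ^+ m *: iter m (lie x) y.
Proof.
elim: m => [|m IH]; first by rewrite expr0 scale1r.
by rewrite /= IH lieZl linearZ scalerA exprS.
Qed.

Lemma iter_lie_linear (x : g) m : linear (iter m (lie x) : g -> g).
Proof. by elim: m => [//|m IH] a u v; rewrite /= IH linearP. Qed.

HB.instance Definition _ x m :=
  GRing.isLinear.Build R[i] g g _ (iter m (lie x)) (iter_lie_linear x m).

Lemma coord_iter_lie x m y i : coord e i (iter m (lie x) y) =
  \sum_(k < n) coord e k y * coord e i (iter m (lie x) e`_k).
Proof.
rewrite [in LHS](basisE y) !linear_sum; apply: eq_bigr => k _.
by rewrite !linearZ.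
Qed.

(* Small t make the exponential series geometrically dominated, uniformly in t. *)
Lemma exp_ad_first_order (x : g) : exists2 c : R[i], 0 < c &
  forall t : R[i], 0 < t -> t * c <= 1 ->
  exists2 phi : 'End(g), is_exp_ad (t *: x) phi &
  exists2 v : 'I_n -> g,
    forall k : 'I_n, phi e`_k = e`_k + t *: lie x e`_k + t ^+ 2 *: v k &
    forall i k, `|coord e i (v k)| <= c.
Proof.
pose c := \sum_(k < n) coord_norm (lie x e`_k).
have c0 : 0 <= c by apply: sumr_ge0 => k _; apply: coord_norm_ge0.
have C0 : 0 < 4 * c ^+ 2 + 2 * c + 1.
  by rewrite ltr_wpDl // addr_ge0 ?mulr_ge0 ?exprn_ge0.
(* The summand 4 c^2 will bound the remainder, 2 c forces t c <= 1/2, and 1 ensures positivity. *)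
exists (4 * c ^+ 2 + 2 * c + 1) => // t t0 tC.
have t0' := ltW t0.
have tc : t * c <= 2^-1.
  rewrite -(ler_pM2l (ltr0n _ 2)) mulfV ?pnatr_eq0 // (le_trans _ tC) //.
  rewrite mulrCA ler_wpM2l // -addrA addrC -addrA lerDl.
  by rewrite addr_ge0 ?mulr_ge0 ?exprn_ge0.
(* Matrix entries of the terms of (exp(t ad x) - 1 - t ad x) / t^2. They are at most c^2 (t c)^m,
   hence at most c^2 2^-m. *)
pose z (ik : 'I_n * 'I_n) m : R[i] :=
  (m.+2`!%:R)^-1 * (t ^+ m * coord e ik.1 (iter m.+2 (lie x) e`_ik.2)).
have /fin_all_exists[L LP] (ik : 'I_n * 'I_n) : exists l,
    forall N, `|\sum_(m < N) z ik m - l| <= 4 * c ^+ 2 * 2 ^- N.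
  apply: geometric_cvg => m; rewrite /z !normrM normfV normr_nat.
  rewrite -[leRHS]mul1r ler_pM ?invr_ge0 ?mulr_ge0 //.
    by rewrite invf_le1 ?ler1n ?ltr0n ?fact_gt0.
  apply: (@le_trans _ _ (t ^+ m * (c ^+ m.+2 * 1))).
    rewrite normrX (ger0_norm t0') ler_wpM2l ?exprn_ge0 //.
    rewrite (le_trans (coord_le_norm _ _)) // (le_trans (iter_lie_norm _ _ _)) //.
    by rewrite coord_norm_basis.
  rewrite mulr1 -addn2 exprD mulrA -exprMn mulrC ler_wpM2l ?exprn_ge0 //.
  by rewrite -exprVn lerXn2r ?nnegrE ?mulr_ge0 ?invr_ge0.
pose v k : g := \sum_(i < n) L (i, k) *: e`_i.
have vE i k : coord e i (v k) = L (i, k).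
  rewrite /v linear_sum (bigD1 i) //= linearZ /= coord_basis eqxx big1 => [|j ji].
    by rewrite addr0 [LHS]mulr1.
  by rewrite linearZ /= coord_basis eq_sym (negPf ji) [LHS]mulr0.
pose F y : g := y + t *: lie x y + t ^+ 2 *: \sum_(k < n) coord e k y *: v k.
have F_lin : linear F.
  move=> a y w; rewrite /F linearP /=.
  have -> : \sum_(k < n) coord e k (a *: y + w) *: v k =
      a *: (\sum_(k < n) coord e k y *: v k) + \sum_(k < n) coord e k w *: v k.
    rewrite scaler_sumr -big_split; apply: eq_bigr => k _ /=.
    by rewrite linearP scalerDl scalerA.
  by rewrite !scalerDr !scalerA ![a * _]mulrC [X in X + _ = _]addrACA [LHS]addrACA.
pose F' := HB.pack_for {linear g -> g} F
  (GRing.isLinear.Build R[i] g g _ F F_lin).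
have FE y : linfun F' y = F y by rewrite lfunE.
exists (linfun F').
  move=> y i eps eps0.
  pose D := complex.Re (4 * c ^+ 2 * coord_norm y * t ^+ 2).
  have DE : D%:C = 4 * c ^+ 2 * coord_norm y * t ^+ 2.
    by rewrite RRe_real // ger0_real // !mulr_ge0 ?exprn_ge0 ?coord_norm_ge0.
  (* Beyond the Archimedean bound, 2^N exceeds D / eps; the shift by 2 accounts for the terms of
     order 0 and 1, which are split off. *)
  exists (Num.Def.archi_bound (D / eps)).+2 => -[|[|N]] // leN.
  have DN : D%:C * 2 ^- N < eps%:C.
    have : D / eps < 2 ^+ N by apply: upper_nthrootP.
    rewrite ltr_pdivrMr // -ltcR rmorphM rmorphXn /= rmorph_nat mulrC.
    by rewrite ltr_pdivrMr ?exprn_gt0.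
  apply: le_lt_trans DN; rewrite FE /F DE.
  (* The error is t^2 times the truncation errors of the series [z], weighted by the coordinates of
     [y]. *)
  have -> : coord e i (\sum_(k < N.+2) k`!%:R^-1 *: iter k (lie (t *: x)) y -
      (y + t *: lie x y + t ^+ 2 *: \sum_(k < n) coord e k y *: v k)) =
    t ^+ 2 * \sum_(k < n) coord e k y * (\sum_(m < N) z (i, k) m - L (i, k)).
    rewrite 2!big_ord_recl /= fact0 invr1 !scale1r lieZl.
    rewrite addrA opprD addrACA subrr add0r linearB /=.
    rewrite [X in _ - X]linearZ /= !linear_sum /=.
    under [in RHS]eq_bigr do rewrite mulrBr.
    rewrite sumrB mulrBr; congr (_ - _); last first.
      by congr (_ * _); apply: eq_bigr => k _; rewrite linearZ /= vE.
    rewrite mulr_sumr.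
    under [in RHS]eq_bigr do rewrite mulr_sumr mulr_sumr.
    rewrite exchange_big; apply: eq_bigr => m _ /=.
    rewrite linearZ /= -[lie _ (lie _ _)]/(iter m.+2 (lie (t *: x)) y).
    rewrite iter_lie_scale linearZ /=.
    rewrite -[coord _ _ (lie x _)]/(coord e i (iter m.+2 (lie x) y)).
    rewrite coord_iter_lie !mulr_sumr.
    by apply: eq_bigr => k _; rewrite /z /= 2!exprS; ring.
  rewrite normrM (ger0_norm (exprn_ge0 _ t0')) [leRHS](_ : _ = t ^+ 2 *
    \sum_(k < n) `|coord e k y| * (4 * c ^+ 2 * 2 ^- N)); last first.
    by rewrite -mulr_suml -/(coord_norm y); ring.
  rewrite ler_wpM2l ?exprn_ge0 // (le_trans (ler_norm_sum _ _ _)) //.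
  by apply: ler_sum => k _; rewrite normrM ler_wpM2l.
exists v; last first.
  (* At N = 0 the partial sum is empty, so the error estimate bounds the limit itself. *)
  move=> i k; rewrite vE; have := LP (i, k) 0%N; rewrite big_ord0 sub0r normrN.
  rewrite expr0 invr1 mulr1 => /le_trans; apply.
  by rewrite -addrA lerDl addr_ge0 ?mulr_ge0.
move=> k; rewrite FE /F (bigD1 k) //= coord_basis eqxx scale1r big1 ?addr0 //.
by move=> j jk; rewrite coord_basis (negPf jk) scale0r.
Qed.
End ExpAd.

(** * Invariants under the adjoint group *)

Section BoundedFamilies.
Variables (K : numFieldType) (I : Type).

(** This is O(1) with a constant uniform in the index, over an arbitrary index type. *)
Definition bounded_scalars (a : I -> K) := exists C, forall i, `|a i| <= C.

Lemma bounded_ext a b : a =1 b -> bounded_scalars a -> bounded_scalars b.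
Proof. by move=> ab [C aC]; exists C => i; rewrite -ab. Qed.

Lemma bounded_cst c : bounded_scalars (fun=> c).
Proof. by exists `|c|. Qed.

Lemma bounded_add a b : bounded_scalars a -> bounded_scalars b ->
  bounded_scalars (fun i => a i + b i).
Proof.
move=> [C aC] [D bD]; exists (C + D) => i.
by rewrite (le_trans (ler_normD _ _)) ?lerD.
Qed.

Lemma bounded_mul a b : bounded_scalars a -> bounded_scalars b ->
  bounded_scalars (fun i => a i * b i).
Proof. by move=> [C aC] [D bD]; exists (C * D) => i; rewrite normrM ler_pM. Qed.

Lemma bounded_sum (J : Type) (r : seq J) (P : pred J) (F : J -> I -> K) :
    (forall j, bounded_scalars (F j)) ->
  bounded_scalars (fun i => \sum_(j <- r | P j) F j i).
Proof.
move=> FC; elim: r => [|j r IH].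
  by apply: bounded_ext (bounded_cst 0) => i; rewrite big_nil.
case Pj : (P j); last by apply: bounded_ext IH => i; rewrite big_cons Pj.
by apply: bounded_ext (bounded_add (FC j) IH) => i; rewrite big_cons Pj.
Qed.

Variable n : nat.
Local Notation S := {mpoly K[n]}.

(** The bound may depend on the monomial: the limit argument in [invariant_sym_ad] looks at one
    coefficient at a time. *)
Definition bounded_polys (q : I -> S) :=
  forall m, bounded_scalars (fun i => (q i)@_m).

Lemma bounded_polys_cst q : bounded_polys (fun=> q).
Proof. by move=> m; apply: bounded_cst. Qed.

Lemma bounded_polys_add p q : bounded_polys p -> bounded_polys q ->
  bounded_polys (fun i => p i + q i).
Proof.
by move=> pC qC m; apply: bounded_ext (bounded_add (pC m) (qC m)) => i; rewrite mcoeffD.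
Qed.

Lemma bounded_polys_scale a q : bounded_scalars a -> bounded_polys q ->
  bounded_polys (fun i => a i *: q i).
Proof.
by move=> aC qC m; apply: bounded_ext (bounded_mul aC (qC m)) => i; rewrite mcoeffZ.
Qed.

Lemma bounded_polys_mul p q : bounded_polys p -> bounded_polys q ->
  bounded_polys (fun i => p i * q i).
Proof.
move=> pC qC m.
apply: (bounded_ext (fun i => esym (mcoeffM (p i) (q i) m))).
by apply: bounded_sum => k; apply: bounded_mul.
Qed.

End BoundedFamilies.

Section FirstOrder.
Variables (K : numFieldType) (g : lieAlgebra K) (x : g).
Variables (I : Type) (t : I -> K) (phi : I -> 'End(g)).
Local Notation n := (\dim {:g}).
Local Notation e := (vbasis {:g}).
Local Notation S := (sym_alg K g).
Hypothesis t_bounded : bounded_scalars t.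

(** Expresses phi = 1 + t D_x + O(t^2) on [p], with the error uniform over the family. *)
Definition first_order (p : S) := exists2 q : I -> S, bounded_polys q &
  forall i, sym_map (phi i) p = p + t i *: sym_ad x p + t i ^+ 2 *: q i.

Lemma first_order_add p p' :
  first_order p -> first_order p' -> first_order (p + p').
Proof.
move=> [q qC pE] [q' qC' pE']; exists (fun i => q i + q' i).
  exact: bounded_polys_add.
move=> i; rewrite /sym_map comp_mpolyD -!/(sym_map _ _) pE pE' linearD /=.
by rewrite !scalerDr [X in _ = X + _]addrACA [RHS]addrACA.
Qed.

Lemma first_order_scale c p : first_order p -> first_order (c *: p).
Proof.
move=> [q qC pE]; exists (fun i => c *: q i).
  by apply: bounded_polys_scale => //; apply: bounded_cst.
move=> i; rewrite /sym_map comp_mpolyZ -!/(sym_map _ _) pE linearZ /=.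
by rewrite !scalerDr !scalerA ![c * _]mulrC.
Qed.

Lemma first_order1 : first_order 1.
Proof.
exists (fun=> 0) => [|i]; first exact: bounded_polys_cst.
by rewrite /sym_map comp_mpoly1 sym_ad1 !scaler0 !addr0.
Qed.

Lemma first_order_mul p p' :
  first_order p -> first_order p' -> first_order (p * p').
Proof.
move=> [q qC pE] [q' qC' pE'].
(* All terms of the product of the two expansions that carry a factor t^2; the linear terms combine
   by the Leibniz rule for [sym_ad]. *)
exists (fun i => q i * (p' + t i *: sym_ad x p' + (t i * t i) *: q' i) +
  (p * q' i + sym_ad x p * (sym_ad x p' + t i *: q' i))).
  have cst := bounded_polys_cst I.
  repeat first [apply: bounded_polys_add | apply: bounded_polys_mul | apply: cst
    | apply: bounded_polys_scale | apply: bounded_mul | exact: t_bounded | exact: qC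
    | exact: qC'].
move=> i; rewrite /sym_map rmorphM /= -!/(sym_map _ _) pE pE' sym_adM.
by rewrite -!mul_mpolyC !rmorphM /= ?rmorphXn /=; ring.
Qed.

Hypothesis phi_first_order : forall k : 'I_n, exists2 v : I -> g,
  forall i, phi i e`_k = e`_k + t i *: lie x e`_k + t i ^+ 2 *: v i &
  forall l : 'I_n, bounded_scalars (fun i => coord e l (v i)).

Lemma first_orderX (k : 'I_n) : first_order 'X_k.
Proof.
have [v vE vC] := phi_first_order k; exists (fun i => sym_in (v i)).
  move=> m; apply: (bounded_ext (a := fun i =>
    \sum_(l < n) coord e l (v i) * ('X_l : S)@_m)).
    by move=> i; rewrite /sym_in raddf_sum; apply: eq_bigr => l _; rewrite /= mcoeffZ.
  by apply: bounded_sum => l; apply: bounded_mul => //; apply: bounded_cst.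
move=> i; rewrite /sym_map comp_mpolyXU -tnth_nth tnth_mktuple vE.
by rewrite -sym_in_basis sym_ad_in -!linearZ -!linearD.
Qed.

Lemma first_order_all p : first_order p.
Proof.
rewrite [p]mpolyE; elim: (msupp p : seq _) => [|m s IH].
  by rewrite big_nil -(scale0r 1); apply/first_order_scale/first_order1.
rewrite big_cons; apply: first_order_add => //; apply: first_order_scale.
rewrite mpolyXE_id; apply: big_ind => [||k _].
- exact: first_order1.
- exact: first_order_mul.
elim: (m k) => [|d IHd]; first exact: first_order1.
by rewrite exprS; apply: first_order_mul IHd; apply: first_orderX.
Qed.

End FirstOrder.

(** Invariance turns the first-order expansion into t D_x p = - t^2 q with [q] bounded, so every
    coefficient of D_x p is O(t) for arbitrarily small t > 0. *)
Lemma invariant_sym_ad (R : realType) (g : lieAlgebra R[i]) (p : sym_alg R[i] g) x :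
  sym_invariant p -> sym_ad x p = 0.
Proof.
move=> p_inv; have [c c0 expP] := exp_ad_first_order x.
(* Indexing by all admissible pairs (t, phi) gives a single bound for all of them, without choosing
   a [phi] for each [t]. *)
pose good (tp : R[i] * 'End(g)) :=
  [/\ 0 < tp.1, tp.1 * c <= 1, is_exp_ad (tp.1 *: x) tp.2 &
    exists2 v : 'I_(\dim {:g}) -> g,
      forall k : 'I_(\dim {:g}), tp.2 (vbasis {:g})`_k =
        (vbasis {:g})`_k + tp.1 *: lie x (vbasis {:g})`_k + tp.1 ^+ 2 *: v k &
      forall i k, `|coord (vbasis {:g}) i (v k)| <= c].
pose t (i : {tp | good tp}) := (sval i).1.
have t_gt0 i : 0 < t i by case: (svalP i).
have t_bd : bounded_scalars t.
  exists c^-1 => i; have [_ tc _ _] := svalP i.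
  by rewrite ger0_norm ?(ltW (t_gt0 i)) // -[leRHS]mul1r ler_pdivlMr.
have [q qC pE] : first_order x t (fun i => (sval i).2) p.
  apply: first_order_all => // k.
  (* The remainder is solved for, since [good] only asserts that some [v] exists for each index. *)
  exists (fun i => (t i ^+ 2)^-1 *: ((sval i).2 (vbasis {:g})`_k -
     ((vbasis {:g})`_k + t i *: lie x (vbasis {:g})`_k))).
    move=> i; have ti0 : t i ^+ 2 != 0 by rewrite expf_neq0 ?gt_eqF ?t_gt0.
    by rewrite scalerA divff // scale1r [RHS]addrC subrK.
  move=> l; exists c => i; have [_ _ _ [v vE vC]] := svalP i.
  rewrite -/(t i) in vE; rewrite vE addrC addKr scalerA mulVf ?scale1r //.
  by rewrite expf_neq0 ?gt_eqF ?t_gt0.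
apply/mpolyP => m; rewrite mcoeff0; have [C qm] := qC m.
set d := (sym_ad x p)@_m.
have small t' : 0 < t' -> t' * c <= 1 -> `|d| <= t' * C.
  move=> t0 tc; have [phi phi_exp phi_v] := expP t' t0 tc.
  have i0 : good (t', phi) by split.
  have := pE (exist _ _ i0); have {}qm := qm (exist _ _ i0).
  rewrite /t /= p_inv; last first.
    by have := Ad_exp phi_exp (Ad_id g); rewrite comp_lfun1r.
  move/(congr1 (fun u => (u - p)@_m)); rewrite subrr -(addrA p) (addrC p) addrK.
  rewrite mcoeff0 mcoeffD !mcoeffZ -/d => /esym/eqP.
  rewrite expr2 -mulrA -mulrDr mulf_eq0 gt_eqF //= addr_eq0 => /eqP->.
  by rewrite normrN normrM ger0_norm ?(ltW t0) // ler_wpM2l // ltW.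
apply/eqP; rewrite -normr_eq0; apply: contraT => d0.
have {d0} d0 : 0 < `|d| by rewrite lt_neqAle eq_sym d0 normr_ge0.
have C0 : 0 <= C.
  have ci0 : 0 < c^-1 by rewrite invr_gt0.
  rewrite -(pmulr_rge0 _ ci0); apply: le_trans (normr_ge0 d) (small _ ci0 _).
  by rewrite mulVf ?gt_eqF.
have D0 : 0 < `|d| * c + C by rewrite ltr_wpDr ?mulr_gt0.
(* This [t] is small enough because C >= 0, and the estimate then gives |d| c + C <= C,
   contradicting |d| c > 0. *)
have := small (`|d| / (`|d| * c + C)).
rewrite divr_gt0 // mulrAC ler_pdivrMr // mul1r lerDl C0 mulrAC => /(_ isT isT).
rewrite ler_pdivlMr // ler_pM2l //.
by rewrite gerDr pmulr_lle0 // => /(lt_le_trans d0); rewrite ltxx.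
Qed.

(** * Harmonicity of the leading symbol of a matrix coefficient *)

Theorem theorem2p7 (R : realType) (g : lieAlgebra R[i])
  (g_semisimple : lie_semisimple g)
  (l : nat) (g_rank : lie_rank g l)
  (B : sym_alg R[i] g -> sym_alg R[i] g -> R[i])
  (B_ext : killing_extension B)
  (p : l.-tuple (sym_alg R[i] g))
  (p_gen : invariant_generators p)
  (U : algType R[i]) (j : {linear g -> U}) (U_env : is_enveloping j)
  (tau : {linear sym_alg R[i] g -> U})
  (tau_sym : is_symmetrization j tau)
  (M : lmodType R[i]) (pi : U -> M -> M) (pi_rep : is_representation pi)
  (chi : {z : U | is_central z} -> R[i])
  (pi_chi : has_infinitesimal_character pi chi)
  (s : M) (s' : {scalar M}) (k : nat) (k_ge1 : (1 <= k)%N)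
  (f_codeg : has_codegree j (fun u => s' (pi u s)) k)
  (fk : sym_alg R[i] g)
  (fk_symbol : is_leading_symbol B tau (fun u => s' (pi u s)) k fk) :
  harmonic p fk /\ fk \is k.-homog.

Proof.
case: fk_symbol => fk_homog fk_rep; split=> // r.
set pr := tnth p r.
have [pr_deg pr_inv _] := p_gen; have [d d_gt0 pr_homog] := pr_deg r.
have pr_central : is_central (tau pr).
  apply: (tau_central U_env tau_sym) => x; apply: invariant_sym_ad.
  by apply/pr_inv; exists 'X_r; rewrite comp_mpolyXU -tnth_nth.
have f_lin a u v : s' (pi (a *: u + v) s) = a * s' (pi u s) + s' (pi v s).
  by rewrite (rep_linear_l pi_rep) linearP.
have f0 u : U_lt j k u -> s' (pi u s) = 0 by case: f_codeg => _ + _; apply.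
apply: (kext_nonsing B_ext) => w; rewrite (sym_deriv_adjoint B_ext).
(* Splitting [w] into monomials makes it homogeneous, so that degrees can be compared with k. *)
rewrite [w]mpolyE; apply: (subspace_sum (Q := fun w => B fk (pr * w) = 0)).
  split=> [|a u v Qu Qv]; last first.
    by rewrite mulrDr -scalerAr (kext_linear B_ext) Qu Qv mulr0 addr0.
  rewrite mulr0; have := kext_linear B_ext fk (-1) 0 0.
  by rewrite scaler0 addr0 mulN1r addNr.
move=> m _; have mon_homog : w@_m *: 'X_[m] \is (mdeg m).-homog.
  by apply: rpredZ; rewrite dhomogX.
move: (w@_m *: _) mon_homog => v v_homog.
have prv_homog := dhomogM pr_homog v_homog.
have [kE | kN] := eqVneq k (d + mdeg m)%N; last first.
  exact: (kext_orth B_ext fk_homog prv_homog kN).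
rewrite fk_rep ?kE //.
(* The central factor is placed on the right, so that it acts on [s] first and becomes a scalar; the
   discarded difference lies in U_(k-1), where the functional vanishes. *)
have -> : s' (pi (tau (pr * v)) s) = s' (pi (tau v * tau pr) s).
  rewrite -pr_central -[tau (pr * v)](subrK (tau pr * tau v)).
  rewrite -[X in X + _]scale1r f_lin f0 ?mulr0 ?add0r // kE.
  exact: (tau_mul_lt U_env tau_sym pr_homog v_homog).
rewrite (rep_mul pi_rep) (pi_chi (exist _ _ pr_central)).
have pi0 u : pi u 0 = 0.
  have := rep_linear_r pi_rep u (-1) 0 0.
  by rewrite scaler0 addr0 scaleN1r addNr.
rewrite -[_ *: s]addr0 (rep_linear_r pi_rep) pi0 addr0 linearZ /=.
(* Since d > 0, the degree of [v] is at most k - 1, so the functional vanishes on [tau v]. *)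
rewrite f0 ?mulr0 // kE; apply: U_ltW (tau_lt tau_sym v_homog).
by rewrite -add1n leq_add2r.
Qed.
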